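(* Let $\alpha=\frac{1-i}{2}$, let $L\subset\mathbb{C}$ be Lévy's dragon curve, let $s=-\frac12+\frac{i}{2}$, and let $L_s=\{z+s: z\in L\}$ be the translate of $L$ by $s$. Then $$L_s=\left\{(1-\alpha)\sum_{n=1}^{\infty}\gamma_n\alpha^n \;:\; (\gamma_n)_{n\ge1}\ \text{follows the directed graph } \mathcal{G}_2\right\}.$$
   Context: Lévy's dragon curve $L$ is the unique non-empty compact subset of $\mathbb{C}$ satisfying $L=\psi_0(L)\cup\psi_1(L)$, where $\psi_0(z)=\frac{1-i}{2}z$ and $\psi_1(z)=\frac{1+i}{2}z+\frac{1-i}{2}$. The directed graph $\mathcal{G}_2$ has eight nodes: for each $u\in\{1,i,-1,-i\}$ there is one ''outer'' node labelled $u$ and one ''inner'' node labelled $u$. Each node has exactly two outgoing arrows, one blue (corresponding to binary digit $0$) and one red (corresponding to binary digit $1$). Blue arrows always end at outer nodes and red arrows always end at inner nodes. From the outer node labelled $u$, the blue arrow is a loop to the same outer node labelled $u$, and the red arrow goes to the inner node labelled $-u$. From the inner node labelled $u$, the blue arrow goes to the outer node labelled $-iu$, and the red arrow goes to the inner node labelled $iu$. A sequence $(\gamma_n)_{n\ge1}\in\{1,-1,i,-i\}^{\mathbb{N}}$ follows $\mathcal{G}_2$ if it is the sequence of labels of the nodes visited by an infinite directed path in $\mathcal{G}_2$ whose first node is either the outer node labelled $-1$ (first binary digit $0$) or the inner node labelled $1$ (first binary digit $1$). Equivalently, there is a sequence $(\omega_n)_{n\ge1}\in\{0,1\}^{\mathbb{N}}$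 such that $\gamma_n=(-1)^{1-\omega_n}\, i^{\,\omega_1+\cdots+\omega_{n-1}}$ for all $n\ge1$ (with empty sum $0$ when $n=1$). *)

(* Defs.v *)
From HB Require Import structures.
From mathcomp Require Import all_boot all_order all_algebra.
From mathcomp Require Import complex.
From mathcomp Require Import all_classical all_reals all_analysis.

Set Implicit Arguments.
Unset Strict Implicit.
Unset Printing Implicit Defensive.

Import Order.TTheory GRing.Theory Num.Theory numFieldNormedType.Exports.

Local Open Scope classical_set_scope.
Local Open Scope ring_scope.

(* R[i] packed as a numClosedFieldType, so that it inherits the norm topology
   that MathComp-Analysis puts on every numeric field, and 'i denotes its
   imaginary unit. *)
Definition Cplx (R : realType) : numClosedFieldType := R[i]%C.

Section Levy.
Variable R : realType.
Local Notation C := (Cplx R).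

Definition alpha : C := (1 - 'i) / 2.

Definition psi0 (z : C) : C := (1 - 'i) / 2 * z.
Definition psi1 (z : C) : C := (1 + 'i) / 2 * z + (1 - 'i) / 2.

Definition is_attractor (K : set C) : Prop :=
  [/\ K !=set0, compact K & K = psi0 @` K `|` psi1 @` K].

(* Definite description: the set K with [is_attractor K] such that every
   attractor equals K.  The default value set0 would be taken only if there
   were no such K. *)
Definition levy_dragon : set C := xget set0 [set K | unique is_attractor K].

Definition translate (s : C) (A : set C) : set C := [set z + s | z in A].

Variant node : Type := Outer of C | Inner of C.

Definition label (v : node) : C :=
  match v with Outer u => u | Inner u => u end.

(* The eight nodes of G_2 are the terms of type [node] satisfying this. *)
Definition G2_node (v : node) : Prop :=
  [\/ label v = 1, label v = 'i, label v = -1 | label v = - 'i].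

Definition blue (v : node) : node :=
  match v with
  | Outer u => Outer u
  | Inner u => Outer (- 'i * u)
  end.

Definition red (v : node) : node :=
  match v with
  | Outer u => Inner (- u)
  | Inner u => Inner ('i * u)
  end.

Definition G2_arrow (v w : node) : Prop :=
  [/\ G2_node v, G2_node w & w = blue v \/ w = red v].

(* Sequences are indexed by n >= 1; the terms of index 0 play no role. *)
Definition follows_G2 (gamma : nat -> C) : Prop :=
  exists p : nat -> node,
    [/\ p 1%N = Outer (-1) \/ p 1%N = Inner 1,
        forall n, (1 <= n)%N -> G2_arrow (p n) (p n.+1)
      & forall n, (1 <= n)%N -> gamma n = label (p n)].

(* w is the sum of the series u_1 + u_2 + ... *)
Definition has_sum (u : nat -> C) (w : C) : Prop :=
  (fun N => \sum_(1 <= n < N) u n) @ \oo --> w.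

End Levy.

Arguments levy_dragon R : clear implicits.

(* Main.v *)
Require Import Defs.
From mathcomp Require Import all_boot all_order all_algebra.
From mathcomp Require Import complex ring lra.
From mathcomp Require Import all_classical all_reals all_analysis.
Import Order.TTheory GRing.Theory Num.Theory numFieldNormedType.Exports.
Local Open Scope classical_set_scope.
Local Open Scope ring_scope.

(** Write psi_0, psi_1 for the two similarities of Levy's curve and let a point
    have address w in {0,1}^nat when it is the limit of
    psi_{w_0} (psi_{w_1} (... psi_{w_(n-1)} (x))), for a bounded choice of
    starting points x.

    The proof rests on a conjugation.  Translating the curve by
    s = (i-1)/2 turns the maps into z |-> alpha z - 1/2 and
    z |-> i alpha z + 1/2 ([translated_psi]): the two translation parts become
    opposite, equal to -/+ (1 - alpha) alpha.  Hence, when the iteration is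
    started at x = -s, which the translation sends to 0, each digit adds
    exactly one term: psi_{w_0} (... psi_{w_(N-1)} (-s)) + s is
    (1 - alpha) times the N-th partial sum of gamma_n alpha^n
    ([run_psi_sum]).  The unit factor of gamma_n records the rotations
    accumulated from the digits equal to 1, and its sign records the last
    digit.  The outer and inner nodes of the graph are precisely these
    two pieces of data, so the sequences following the graph are the label
    sequences of digit sequences ([follows_G2P]).  Letting N tend to infinity,
    the sum of the series is the translate of the point with address w.

    It remains to see that the curve is the set of all points with an address.
    For any pair of maps of the complex plane contracting with a common ratio
    r < 1, the point [coding f w] with address w exists because the iterates
    form a Cauchy sequence.  It depends continuously on w in the Cantor space,
    so the set of these points is compact ([coding_invariant_compact]).
    Conversely every point of a compact invariant set K has an
    address, obtained by repeatedly choosing a preimage in K, and every address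
    is reached because K is closed ([invariant_compact_unique]).  This yields
    existence and uniqueness of the attractor at once. *)

(** * Real-valued modulus and convergence in the complex plane *)

(** The norm of [Cplx R] takes its values in [Cplx R] itself; a modulus with
    values in [R] makes real order, limits and compactness available. *)
Definition modulus {R : realType} (z : Cplx R) : R := complex.Re `|z|.

Lemma modulusE (R : realType) (z : Cplx R) :
  `|z| = ((modulus z)%:C)%C :> Cplx R.
Proof. by rewrite /modulus RRe_real. Qed.

Lemma modulus_ge0 (R : realType) (z : Cplx R) : 0 <= modulus z.
Proof. by rewrite -ler0c -modulusE. Qed.

Lemma modulusN (R : realType) (z : Cplx R) : modulus (- z) = modulus z.
Proof. by rewrite /modulus normrN. Qed.

Lemma modulusB (R : realType) (x y : Cplx R) : modulus (x - y) = modulus (y - x).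
Proof. by rewrite /modulus distrC. Qed.

Lemma modulusD (R : realType) (x y : Cplx R) :
  modulus (x + y) <= modulus x + modulus y.
Proof. by rewrite -lecR rmorphD /= -!modulusE; exact: ler_normD. Qed.

Lemma modulusM (R : realType) (x y : Cplx R) :
  modulus (x * y) = modulus x * modulus y.
Proof. by apply: complexI; rewrite rmorphM /= -!modulusE; exact: normrM. Qed.

Lemma modulus_le_ReIm (R : realType) (z : Cplx R) :
  modulus z <= `|complex.Re z| + `|complex.Im z|.
Proof.
rewrite /modulus normc_def /= -[leRHS]ger0_norm ?addr_ge0// -sqrtr_sqr.
by rewrite ler_wsqrtr// sqrrD !real_normK ?num_real// lerD2r lerDl mulrn_wge0// mulr_ge0.
Qed.

Lemma Re_le_modulus (R : realType) (z : Cplx R) : `|complex.Re z| <= modulus z.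
Proof. by rewrite -lecR -modulusE; exact: normc_ge_Re. Qed.

Lemma Im_le_modulus (R : realType) (z : Cplx R) : `|complex.Im z| <= modulus z.
Proof.
rewrite /modulus normc_def /= -sqrtr_sqr ler_wsqrtr//.
by rewrite lerDr sqr_ge0.
Qed.

Lemma cvg_modulusP (R : realType) (T : Type) (F : set_system T) (FF : Filter F)
    (f : T -> Cplx R) (l : Cplx R) :
  f @ F --> l <->
  forall e : R, 0 < e -> \forall x \near F, modulus (l - f x) < e.
Proof.
rewrite (cvgrPdist_lt f l); split=> [h e e0|h e e0].
  have := h (e%:C)%C; rewrite ltcR => /(_ e0).
  by apply: filterS => x; rewrite modulusE ltcR.
move: (e0); rewrite -(RRe_real (gtr0_real e0)) ltcR => e0'.
by have := h _ e0'; apply: filterS => x; rewrite modulusE ltcR.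
Qed.

Lemma cvg_modulus_squeeze (R : realType) (T : Type) (F : set_system T)
    (FF : Filter F) (f : T -> Cplx R) (g : T -> R) (l : Cplx R) :
  (forall x, modulus (l - f x) <= g x) -> g @ F --> 0 -> f @ F --> l.
Proof.
move=> fg g0; apply/cvg_modulusP => e e0.
have : \forall x \near F, g x < e by exact: cvgr_lt g0 _ e0.
apply: filterS => x; exact: le_lt_trans (fg x).
Qed.

Lemma cvg_expr0 (R : realType) (M r : R) : 0 <= r -> r < 1 ->
  (fun n => M * r ^+ n) @ \oo --> 0.
Proof.
by move=> r0 r1; have := @cvg_geometric R M r; rewrite ger0_norm//; apply.
Qed.

Lemma fast_cauchy_cvg_real (R : realType) (u : nat -> R) (g : nat -> R) :
  g @ \oo --> 0 -> (forall n k, `|u n - u (n + k)%N| <= g n) ->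
  exists l : R, u @ \oo --> l.
Proof.
move=> g0 ug; suff h : cvgn u by exists (limn u).
apply: cauchy_cvg; apply: cauchy_exP => e e0.
have [n _ /(_ n (leqnn n)) /= gn] : \forall n \near \oo, g n < e.
  exact: cvgr_lt g0 _ e0.
exists (u n); exists n => // m /= nm.
by rewrite /ball /= -(subnKC nm); apply: le_lt_trans gn.
Qed.

(** Completeness of the plane comes from that of the line, coordinate by
    coordinate; the rate [g] survives the passage to the limit. *)
Lemma fast_cauchy_cvg (R : realType) (u : nat -> Cplx R) (g : nat -> R) :
  g @ \oo --> 0 -> (forall n k, modulus (u n - u (n + k)%N) <= g n) ->
  exists2 l : Cplx R, u @ \oo --> l & forall n, modulus (l - u n) <= g n.
Proof.
move=> g0 ug.
have [a ua] : exists a : R, (fun n => complex.Re (u n)) @ \oo --> a.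
  apply: (@fast_cauchy_cvg_real _ _ _ g0) => n k.
  rewrite -(raddfB (@complex.Re R)).
  exact: le_trans (Re_le_modulus _ _) (ug n k).
have [b ub] : exists b : R, (fun n => complex.Im (u n)) @ \oo --> b.
  apply: (@fast_cauchy_cvg_real _ _ _ g0) => n k.
  rewrite -(raddfB (@complex.Im R)).
  exact: le_trans (Im_le_modulus _ _) (ug n k).
pose l : Cplx R := (a +i* b)%C.
have ul : u @ \oo --> l.
  apply: (@cvg_modulus_squeeze _ _ _ _ _
    (fun n => `|a - complex.Re (u n)| + `|b - complex.Im (u n)|)).
    move=> n; apply: le_trans (modulus_le_ReIm _ _) _.
    by rewrite !raddfB.
  rewrite -[X in _ --> X](addr0 0) -(@normr0 _ R).
  apply: cvgD; apply: cvg_norm.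
    by rewrite -[X in _ --> X](subrr a); apply: cvgB => //; exact: cvg_cst.
  by rewrite -[X in _ --> X](subrr b); apply: cvgB => //; exact: cvg_cst.
exists l => // n; apply/ler_addgt0Pr => e e0.
have [m _ /(_ (n + m)%N (leq_addl _ _)) /= um] := (cvg_modulusP _ _ _ _ _ _).1 ul _ e0.
have -> : l - u n = (u (n + m)%N - u n) + (l - u (n + m)%N) by ring.
apply: le_trans (modulusD _ _ _) _; apply: lerD; last exact: ltW.
by rewrite modulusB.
Qed.

(** * Pairs of contractions and their attractor *)

Definition shift {T : Type} (n : nat) (w : nat -> T) : nat -> T :=
  fun k => w (n + k)%N.

Fixpoint run {T I : Type} (f : I -> T -> T) (w : nat -> I) (n : nat) (x : T) : T :=
  if n is m.+1 then f (w 0%N) (run f (shift 1 w) m x) else x.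

Lemma runD (T I : Type) (f : I -> T -> T) (w : nat -> I) n k x :
  run f w (n + k) x = run f w n (run f (shift n w) k x).
Proof. by elim: n w => [//|n IH] w; rewrite addSn /= IH. Qed.

(** Unfolding at the innermost map, whereas the definition unfolds at the
    outermost one. *)
Lemma runSr (T I : Type) (f : I -> T -> T) (w : nat -> I) n x :
  run f w n.+1 x = run f w n (f (w n) x).
Proof. by rewrite -addn1 runD /= /shift addn0. Qed.

Lemma eq_run (T I : Type) (f : I -> T -> T) (w v : nat -> I) n x :
  (forall k, (k < n)%N -> w k = v k) -> run f w n x = run f v n x.
Proof.
elim: n w v => [//|n IH] w v wv /=.
by rewrite wv// (IH _ (shift 1 v))// => k kn; exact: wv.
Qed.

Definition invariant_compact {R : realType} (f : bool -> Cplx R -> Cplx R)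
    (K : set (Cplx R)) : Prop :=
  [/\ K !=set0, compact K & K = f false @` K `|` f true @` K].

Definition contracting {R : realType} (r : R) (f : bool -> Cplx R -> Cplx R) :=
  [/\ 0 <= r, r < 1 &
      forall b x y, modulus (f b x - f b y) <= r * modulus (x - y)].

Definition coding {R : realType} (f : bool -> Cplx R -> Cplx R)
    (w : nat -> bool) : Cplx R :=
  limn (fun n => run f w n 0).

Lemma run_contracts (R : realType) (r : R) f : contracting r f ->
  forall w n x y,
    modulus (run f w n x - run f w n y) <= r ^+ n * modulus (x - y).
Proof.
case=> r0 r1 fr w n x y; elim: n w => [|n IH] w /=; first by rewrite mul1r.
by apply: le_trans (fr _ _ _) _; rewrite exprS -mulrA ler_wpM2l.
Qed.

(** With D bounding the moduli of both [f b 0], the disc of radius D / (1 - r)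
    is mapped into itself, since r D / (1 - r) + D = D / (1 - r). *)
Lemma run_bounded (R : realType) (r : R) f : contracting r f ->
  exists M, forall w n, modulus (run f w n 0) <= M.
Proof.
case=> r0 r1 fr.
pose D := modulus (f false 0) + modulus (f true 0).
have fD b : modulus (f b 0) <= D.
  by case: b; rewrite /D ?lerDr ?lerDl modulus_ge0.
have r'0 : 0 < 1 - r by rewrite subr_gt0.
exists (D / (1 - r)) => w n; elim: n w => [|n IH] w /=.
  rewrite /modulus normr0 /=; apply: divr_ge0; last exact: ltW.
  exact: le_trans (modulus_ge0 _ (f true 0)) (fD true).
set y := run _ _ _ _.
have -> : f (w 0%N) y = (f (w 0%N) y - f (w 0%N) 0) + f (w 0%N) 0 by ring.
apply: le_trans (modulusD _ _ _) _.
apply: (@le_trans _ _ (r * (D / (1 - r)) + D)).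
  apply: lerD => //; apply: le_trans (fr _ _ _) _.
  by rewrite subr0 ler_wpM2l//; exact: IH.
rewrite le_eqVlt; apply/orP; left; apply/eqP; field.
exact: lt0r_neq0.
Qed.

(** The iterates with n and n + k digits start with the same n maps, so they
    differ by at most r^n times the bound on the orbits.  The constant M is
    uniform in the address, which is what continuity needs. *)
Lemma coding_spec (R : realType) (r : R) f : contracting r f ->
  exists M : R, forall w,
    (fun n => run f w n 0) @ \oo --> coding f w /\
    forall n, modulus (coding f w - run f w n 0) <= M * r ^+ n.
Proof.
move=> fC; have [r0 r1 fr] := fC; have [M runM] := run_bounded _ _ _ fC.
exists M => w.
have [|l ul lM] := fast_cauchy_cvg _ (fun n => run f w n 0) _ (cvg_expr0 _ M r r0 r1).
  move=> n k; rewrite runD modulusB.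
  apply: le_trans (run_contracts _ _ _ fC _ _ _ _) _.
  by rewrite subr0 mulrC ler_wpM2r// exprn_ge0.
by have -> : coding f w = l by exact/(cvg_lim _ ul)/norm_hausdorff.
Qed.

(** The starting point may vary with n as long as it stays bounded: it is
    contracted by r^n.  Varying points occur for addresses of points of an
    invariant set, constant ones for the starting point -s. *)
Lemma run_cvg (R : realType) (r : R) f : contracting r f ->
  forall w (x : nat -> Cplx R) B, (forall n, modulus (x n) <= B) ->
  (fun n => run f w n (x n)) @ \oo --> coding f w.
Proof.
move=> fC w x B xB; have [r0 r1 _] := fC; have [M cM] := coding_spec _ _ _ fC.
apply: (@cvg_modulus_squeeze _ _ _ _ _ (fun n => (M + B) * r ^+ n)); last first.
  exact: cvg_expr0.
move=> n.
have -> : coding f w - run f w n (x n) =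
  (coding f w - run f w n 0) + (run f w n 0 - run f w n (x n)) by ring.
apply: le_trans (modulusD _ _ _) _; rewrite mulrDl lerD ?(cM w).2//.
apply: le_trans (run_contracts _ _ _ fC _ _ _ _) _.
by rewrite sub0r modulusN mulrC ler_wpM2r// exprn_ge0.
Qed.

Lemma coding_shift (R : realType) (r : R) f : contracting r f ->
  forall w, coding f w = f (w 0%N) (coding f (shift 1 w)).
Proof.
move=> fC w; have [r0 r1 fr] := fC; have [M cM] := coding_spec _ _ _ fC.
apply: (cvg_unique (@norm_hausdorff _ _) (F := (fun n => run f w n.+1 0) @ \oo)).
  by have := (cM w).1; rewrite -cvg_shiftS.
apply: (@cvg_modulus_squeeze _ _ _ _ _ (fun n => (r * M) * r ^+ n)); last first.
  exact: cvg_expr0.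
move=> n /=; apply: le_trans (fr _ _ _) _.
by rewrite -mulrA ler_wpM2l// (cM _).2.
Qed.

(** Cylinders are neighbourhoods in the product topology. *)
Lemma near_prefix (w : prod_topology (fun _ : nat => bool)) n :
  \forall v \near w, forall k, (k < n)%N -> w k = v k.
Proof.
elim: n => [|n IH]; first by apply: (@nearW _ (nbhs w)) => v k; rewrite ltn0.
have wn : \forall v \near w, w n = v n.
  have : \forall v \near w, [set w n] (v n).
    exact: (@proj_continuous nat (fun _ => bool) n w _ (discrete_set1 (w n))).
  by apply: filterS => v /= ->.
apply: filterS2 wn IH => v wn IH k; rewrite ltnS leq_eqVlt.
by case/orP => [/eqP ->|/IH].
Qed.

(** Addresses with the same first n digits share their n-th iterate, which is
    within M r^n of both coded points. *)
Lemma coding_continuous (R : realType) (r : R) f : contracting r f ->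
  continuous (coding f : prod_topology (fun _ : nat => bool) -> Cplx R).
Proof.
move=> fC w; have [r0 r1 _] := fC; have [M cM] := coding_spec _ _ _ fC.
apply/cvg_modulusP => e e0.
have [n _ /(_ n (leqnn n)) /= ne] : \forall n \near \oo, (M + M) * r ^+ n < e.
  exact: cvgr_lt (cvg_expr0 _ _ _ r0 r1) _ e0.
have := near_prefix w n; apply: filterS => v wv; apply: le_lt_trans ne.
have -> : coding f w - coding f v =
  (coding f w - run f w n 0) - (coding f v - run f v n 0).
  by rewrite (eq_run _ _ f w v)//; ring.
by apply: le_trans (modulusD _ _ _) _; rewrite modulusN mulrDl lerD ?(cM _).2.
Qed.

Lemma coding_invariant_compact (R : realType) (r : R) f : contracting r f ->
  invariant_compact f (range (coding f)).
Proof.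
move=> fC; split.
- by exists (coding f (fun=> false)), (fun=> false).
- apply: (@continuous_compact _ _ (coding f : prod_topology (fun _ : nat => bool) -> _)).
    by apply: continuous_subspaceT; exact: coding_continuous fC.
  exact: cantor_space_compact.
- apply/seteqP; split=> [_ [w _ <-]|].
    rewrite (coding_shift _ _ _ fC).
    by case: (w 0%N); [right|left];
      exists (coding f (shift 1 w)) => //; exists (shift 1 w).
  have fcons b w : range (coding f) (f b (coding f w)).
    exists (fun n => if n is m.+1 then w m else b) => //.
    by rewrite (coding_shift _ _ _ fC).
  by move=> _ [|] [_ [w _ <-] <-].
Qed.

(** The modulus, being 1-Lipschitz, maps K to a compact set of reals. *)
Lemma compact_modulus_bounded (R : realType) (K : set (Cplx R)) :
  compact K -> exists B, forall z, K z -> modulus z <= B.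
Proof.
move=> cK.
have triangle (a b : Cplx R) : modulus a <= modulus b + modulus (a - b).
  by rewrite -{1}(subrKC b a) modulusD.
have mc : continuous (modulus : Cplx R -> R).
  move=> z; apply/(@cvgrPdist_lt _ _ _ (nbhs z)) => e e0.
  have zz : id @ nbhs z --> z by exact: cvg_id.
  have near_z : \forall x \near z, modulus (z - x) < e.
    exact: ((cvg_modulusP _ _ (nbhs z) _ _ _).1 zz e e0).
  apply: filterS near_z => x; apply: le_lt_trans.
  have := triangle z x; have := triangle x z; rewrite (modulusB _ x z).
  by move=> xz zx; rewrite ler_norml; apply/andP; split; lra.
have /compact_bounded [B [_ /(_ (B + 1))]] : compact (modulus @` K).
  by apply: continuous_compact => //; exact: continuous_subspaceT.
rewrite ltrDl ltr01 => /(_ isT) KB; exists (B + 1) => z Kz.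
have /= := KB (modulus z) (ex_intro2 _ _ z Kz erefl).
by rewrite ger0_norm ?modulus_ge0.
Qed.

(** By invariance each point of K has a preimage in K under one of the maps;
    iterating a choice of preimages reads off the digits. *)
Lemma invariant_point_address (R : realType) f (K : set (Cplx R)) z :
  invariant_compact f K -> K z ->
  exists w, exists2 x : nat -> Cplx R, forall n, K (x n) &
    forall n, z = run f w n (x n).
Proof.
case=> _ _ KE Kz.
have back (y : {y | K y}) : {by' : bool * {y | K y} | f by'.1 (sval by'.2) = sval y}.
  apply: cid; case: y => y Ky /=; have := Ky; rewrite {1}KE.
  by case=> -[x Kx <-]; [exists (false, exist _ x Kx)|exists (true, exist _ x Kx)].
pose next y := (sval (back y)).2.
pose x n := iter n next (exist _ z Kz).
exists (fun n => (sval (back (x n))).1), (fun n => sval (x n)).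
  by move=> n; exact: svalP (x n).
elim=> [//|n IH]; rewrite runSr /= -/(next _) {1}IH.
by congr run; exact/esym/(svalP (back (x n))).
Qed.

Lemma invariant_compact_unique (R : realType) (r : R) f : contracting r f ->
  forall K, invariant_compact f K -> K = range (coding f).
Proof.
move=> fC K Kinv; have [[x0 Kx0] cK KE] := Kinv; apply/seteqP; split=> [z Kz|].
  have [B KB] := compact_modulus_bounded _ _ cK.
  have [w [x Kx zx]] := invariant_point_address _ _ _ _ Kinv Kz.
  exists w => //; apply: (cvg_unique (@norm_hausdorff _ _)
    (F := (fun n => run f w n (x n)) @ \oo)).
    by apply: (run_cvg _ _ _ fC _ _ B) => n; exact/KB/Kx.
  rewrite (_ : (fun n => _) = fun=> z); first exact: cvg_cst.
  by apply/funext => n; rewrite [RHS](zx n).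
move=> _ [w _ <-].
have runK n v : K (run f v n x0).
  elim: n v => [//|n IH] v /=; rewrite KE.
  by case: (v 0%N); [right|left]; exists (run f (shift 1 v) n x0).
have lim_run := run_cvg _ _ _ fC w (fun=> x0) (modulus x0) (fun=> lexx _).
apply: closed_cvg lim_run.
  exact: compact_closed (@norm_hausdorff _ _) cK.
by apply: nearW => n; exact: runK.
Qed.

(** * The dragon curve and its translate *)

Definition psi {R : realType} (b : bool) : Cplx R -> Cplx R :=
  if b then @psi1 R else @psi0 R.

Lemma sqri (R : realType) : 'i * 'i = -1 :> Cplx R.
Proof. by rewrite -expr2 sqrCi. Qed.

Lemma psiE (R : realType) b (z : Cplx R) :
  psi b z = (if b then 'i else 1) * alpha R * z + (if b then alpha R else 0).
Proof.
case: b => /=; rewrite ?/psi1 ?/psi0 /alpha ?mul1r ?addr0//.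
by congr (_ * _ + _); rewrite mulrA mulrBr sqri opprK mulr1 addrC.
Qed.

(** Both maps have ratio |alpha|, and 2 alpha^2 = -i gives |alpha|^2 = 1/2. *)
Lemma psi_contracting (R : realType) :
  contracting (modulus (alpha R)) (@psi R).
Proof.
have modulus_i : modulus ('i : Cplx R) = 1 by rewrite /modulus normCi.
have modulus1 : modulus (1 : Cplx R) = 1 by rewrite /modulus normr1.
have modulus2 : modulus (2 : Cplx R) = 2.
  by apply: complexI; rewrite -modulusE normr_nat rmorph_nat.
split; first exact: modulus_ge0.
  have : 2 * (modulus (alpha R) * modulus (alpha R)) = 1.
    have alpha2 : 2 * (alpha R * alpha R) = - 'i.
      have -> : 2 * (alpha R * alpha R) = (1 + 'i * 'i) / 2 - 'i.
        by rewrite /alpha; field.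
      by rewrite sqri subrr mul0r sub0r.
    by rewrite -{1}modulus2 -!modulusM alpha2 modulusN.
  by have := modulus_ge0 _ (alpha R); nra.
move=> b x y; rewrite !psiE opprD addrACA subrr addr0 -mulrBr !modulusM.
by case: b; rewrite ?modulus_i ?modulus1 mul1r.
Qed.

Lemma levy_dragonE (R : realType) : levy_dragon R = range (coding (@psi R)).
Proof.
have psiC := psi_contracting R.
have dragon : is_attractor (range (coding (@psi R))) :=
  coding_invariant_compact _ _ _ psiC.
apply: xget_unique.
  by split=> // K Kattr; rewrite [RHS](invariant_compact_unique _ _ _ psiC K Kattr).
by move=> K [_]; apply.
Qed.

(** i to the number of digits 1 among the first n, the accumulated rotation. *)
Fixpoint turn {R : realType} (w : nat -> bool) (n : nat) : Cplx R :=
  if n is m.+1 then (if w m then 'i else 1) * turn w m else 1.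

(** The node reached by reading digit [b] after accumulated rotation [t]. *)
Definition signed_node {R : realType} (b : bool) (t : Cplx R) : node R :=
  if b then Inner t else Outer (- t).

(** Reading digit [b] multiplies the rotation by i^b; the arrows of the graph do
    exactly this update, and the colour of the arrow is the next digit. *)
Lemma step_signed_node (R : realType) b b' (t : Cplx R) :
  signed_node b' ((if b then 'i else 1) * t) =
  if b' then red (signed_node b t) else blue (signed_node b t).
Proof.
by case: b b' => -[] /=; rewrite ?mul1r ?opprK ?mulNr.
Qed.

(** The rotations stay among the four units 1, i, -1, -i. *)
Lemma G2_signed_node (R : realType) w n b : G2_node (signed_node b (@turn R w n)).
Proof.
have : [\/ @turn R w n = 1, @turn R w n = 'i,
           @turn R w n = -1 | @turn R w n = - 'i].
  elim: n => [|n IH] /=; first by constructor 1.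
  case: (w n); rewrite ?mul1r//.
  case: IH => ->; rewrite ?mulr1 ?mulrN ?mulr1 ?sqri ?opprK.
  - by constructor 2.
  - by constructor 3.
  - by constructor 4.
  - by constructor 1.
rewrite /G2_node /signed_node; case: b => //=.
by case=> ->; rewrite ?opprK;
  [constructor 3|constructor 4|constructor 1|constructor 2].
Qed.

(** gamma_{n+1}: digits are indexed from 0, the graph's sequences from 1. *)
Definition digit_label {R : realType} (w : nat -> bool) (n : nat) : Cplx R :=
  label (signed_node (w n) (turn w n)).

(** A path determines its digits, as inner nodes are those entered on digit 1;
    the node itself is then forced by [step_signed_node] and the initial node. *)
Lemma follows_G2P (R : realType) (gamma : nat -> Cplx R) :
  follows_G2 gamma <-> exists w, forall n, gamma n.+1 = digit_label w n.
Proof.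
split=> [[p [p1 parr pgamma]]|[w wgamma]].
  pose w n := if p n.+1 is Inner _ then true else false.
  exists w => n; rewrite pgamma//; congr label.
  elim: n => [|n IH]; first by rewrite /w; case: p1 => -> /=; rewrite ?opprK.
  rewrite step_signed_node -IH /w.
  have [_ _ [->|->]] := parr n.+1 isT; by case: (p n.+1).
exists (fun n => signed_node (w n.-1) (turn w n.-1)); split.
- by case: (w 0%N); [right|left].
- case=> [//|n] _; split; [exact: G2_signed_node|exact: G2_signed_node|].
  rewrite step_signed_node; by case: (w n.+1); [right|left].
- by case=> [//|n] _; exact: wgamma.
Qed.

Lemma run_psi_affine (R : realType) w n (x y : Cplx R) :
  run psi w n x - run psi w n y = turn w n * alpha R ^+ n * (x - y).
Proof.
elim: n x y => [|n IH] x y; first by rewrite !mul1r.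
rewrite !runSr IH !psiE exprS /=; ring.
Qed.

(** The displacement of the base point -s is -1/2 under psi_0 and 1/2 under
    psi_1, and (1 - alpha) alpha = 1/2; the rotation [t] is carried along so that
    the sign becomes the label of a node. *)
Lemma translated_psi (R : realType) b (t : Cplx R) (s := - (1 / 2) + 'i / 2) :
  t * (psi b (- s) + s) =
  (1 - alpha R) * (label (signed_node b t) * alpha R).
Proof.
have i2 := sqri R.
rewrite psiE /signed_node /s /alpha.
case: b => /=.
  have -> : t * ('i * ((1 - 'i) / 2) * - (- (1 / 2) + 'i / 2) + (1 - 'i) / 2
                 + (- (1 / 2) + 'i / 2))
    = t * ('i - 2 * ('i * 'i) + 'i * ('i * 'i)) / 4 by field.
  have -> : (1 - (1 - 'i) / 2) * (t * ((1 - 'i) / 2)) = t * (1 - 'i * 'i) / 4 by field.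
  by rewrite i2; field.
have -> : t * (1 * ((1 - 'i) / 2) * - (- (1 / 2) + 'i / 2) + 0 + (- (1 / 2) + 'i / 2))
    = t * ('i * 'i - 1) / 4 by field.
have -> : (1 - (1 - 'i) / 2) * (- t * ((1 - 'i) / 2)) = t * ('i * 'i - 1) / 4 by field.
by [].
Qed.

(** Appending a digit moves the innermost point from -s to psi_b (-s); the
    earlier maps act on this displacement by their common linear part
    i^k alpha^N, which gives the next term of the series. *)
Lemma run_psi_sum (R : realType) w N (s := - (1 / 2) + 'i / 2) :
  run psi w N (- s) + s =
  (1 - alpha R) * \sum_(1 <= n < N.+1) digit_label w n.-1 * alpha R ^+ n.
Proof.
elim: N => [|N IH]; first by rewrite big_geq// mulr0 /= addrC subrr.
rewrite big_nat_recr// mulrDr -IH runSr [N.+1.-1]/=.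
have := run_psi_affine R w N (psi (w N) (- s)) (- s).
rewrite opprK => /(canRL (subrK _)) ->.
rewrite -addrA addrC; congr (_ + _).
rewrite /digit_label exprS mulrAC.
by rewrite translated_psi; ring.
Qed.

Theorem mainTheorem2 (R : realType) :
  let s : Cplx R := - (1 / 2) + 'i / 2 in
  translate s (levy_dragon R) =
  [set z : Cplx R | exists (gamma : nat -> Cplx R) (w : Cplx R),
     [/\ follows_G2 gamma,
         has_sum (fun n => gamma n * alpha R ^+ n) w
       & z = (1 - alpha R) * w]].
Proof.
move=> s.
have a1 : 1 - alpha R != 0.
  apply/eqP => a1; have [_ + _] := psi_contracting R.
  by rewrite -(subr0_eq a1) /modulus normr1 ltxx.
have sumP w : has_sum (fun n => digit_label w n.-1 * alpha R ^+ n)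
    ((1 - alpha R)^-1 * (coding psi w + s)).
  (* the sum over 1 <= n < N has N - 1 terms, hence the shift by one *)
  rewrite /has_sum -cvg_shiftS.
  rewrite (_ : (fun N => _) = fun N => (1 - alpha R)^-1 * (run psi w N (- s) + s)).
    apply: cvgMr; apply: cvgD; last exact: cvg_cst.
    exact: (run_cvg _ _ _ (psi_contracting R) w (fun=> - s) _ (fun=> lexx _)).
  by apply/funext => N /=; rewrite run_psi_sum mulKf.
rewrite levy_dragonE; apply/seteqP; split=> [_ [_ [w _ <-] <-]|z].
  exists (fun n => digit_label w n.-1), ((1 - alpha R)^-1 * (coding psi w + s)).
  split=> //; last by rewrite mulVKf.
  by apply/follows_G2P; exists w.
case=> gamma [l [/follows_G2P[w wgamma] lsum ->]].
exists (coding psi w); first by exists w.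
suff -> : l = (1 - alpha R)^-1 * (coding psi w + s) by rewrite mulVKf.
apply: (cvg_unique (@norm_hausdorff _ _)) lsum _.
rewrite (_ : (fun N => _) =
  (fun N => \sum_(1 <= n < N) digit_label w n.-1 * alpha R ^+ n)).
  exact: sumP.
apply/funext => N; apply: eq_big_nat => -[//|n] _.
by rewrite wgamma.
Qed.
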